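(* Let $\Phi,\Psi:c_0\to c_0$ be linear maps such that $\Phi$ is continuous and $(\Phi,\Psi)$ is Jordan-triple multiplicative. Then $\Psi$ is continuous.
   Context: $c_0$ is the commutative C$^*$-algebra of complex sequences converging to $0$, with pointwise operations and the sup norm. The pair $(\Phi,\Psi)$ of linear maps $A\to B$ between complex Banach algebras is Jordan-triple multiplicative if $\Phi(aba)=\Phi(a)\Psi(b)\Phi(a)$ and $\Psi(aba)=\Psi(a)\Phi(b)\Psi(a)$ for all $a,b\in A$. Continuity is with respect to the norm topologies. *)

(* Defs.v *)
From HB Require Import structures.
From mathcomp Require Import all_boot all_order all_algebra complex.
From mathcomp Require Import all_classical all_reals.
From mathcomp Require Import topology normedtype sequences.

Set Implicit Arguments.
Unset Strict Implicit.
Unset Printing Implicit Defensive.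

Import Order.TTheory GRing.Theory Num.Theory.
Import numFieldNormedType.Exports ComplexField.Normc.

Local Open Scope classical_set_scope.
Local Open Scope complex_scope.
Local Open Scope ring_scope.

(* The product is the only part of the algebra structure involved. MathComp
   has no non-unital rings, so the product is that of a [semigroupType]; the
   group-scope [*] below is the multiplication of the algebra. *)
Definition jordan_triple_multiplicative (A B : semigroupType)
    (Phi Psi : A -> B) : Prop :=
  (forall a b : A, Phi (a * b * a)%g = (Phi a * Psi b * Phi a)%g) /\
  (forall a b : A, Psi (a * b * a)%g = (Psi a * Phi b * Psi a)%g).

Section C0.
Variable R : realType.

(* [R[i]] is also a module over [R]; [^o] selects the complex-linear structure
   and the topology given by the modulus. *)
Local Notation C := (R[i]^o).

Definition c0_seq : {pred nat -> C} :=
  fun u => `[< u n @[n --> \oo] --> (0 : C) >].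

Record c0 := MkC0 { c0_val :> nat -> C ; c0_valP : c0_val \in c0_seq }.

HB.instance Definition _ := [isSub for c0_val].
HB.instance Definition _ := [Choice of c0 by <:].

Lemma c0_seqP (u : nat -> C) :
  reflect (u n @[n --> \oo] --> (0 : C)) (u \in c0_seq).
Proof. exact: asboolP. Qed.

Lemma c0_seq_submod : submod_closed c0_seq.
Proof.
split; first by apply/c0_seqP; exact: cvg_cst.
move=> a u v /c0_seqP u0 /c0_seqP v0; apply/c0_seqP.
rewrite -[0]addr0; apply: cvgD => //.
rewrite -[0](scaler0 _ a); exact: cvgZl_tmp.
Qed.

HB.instance Definition _ := GRing.isSubmodClosed.Build C (nat -> C) c0_seq
  c0_seq_submod.
HB.instance Definition _ := [SubChoice_isSubLmodule of c0 by <:].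

Lemma c0_cvg (u : c0) : u n @[n --> \oo] --> (0 : C).
Proof. exact/c0_seqP/c0_valP. Qed.

Lemma c0_val_inj : injective c0_val.
Proof. exact: val_inj. Qed.

Lemma c0_valD (u v : c0) n : (u + v) n = u n + v n.
Proof. by []. Qed.

Lemma c0_valZ (a : C) (u : c0) n : (a *: u) n = a * u n.
Proof. by []. Qed.

Lemma c0_mul_subproof (u v : c0) :
  (fun n => u n * v n : C) \in c0_seq.
Proof.
apply/c0_seqP; rewrite -[0](mulr0 (0 : C)).
by apply: cvgM; exact: c0_cvg.
Qed.

Definition c0_mul (u v : c0) : c0 := MkC0 (c0_mul_subproof u v).

Lemma c0_mulA : associative c0_mul.
Proof. by move=> u v w; apply/c0_val_inj/funext => n /=; rewrite mulrA. Qed.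

HB.instance Definition _ := isSemigroup.Build c0 c0_mulA.

Lemma c0_valM (u v : c0) n : (u * v)%g n = u n * v n.
Proof. by []. Qed.

Definition sup_norm (u : c0) : R := sup (range (fun n => normc (u n))).

Lemma c0_has_sup (u : c0) : has_sup (range (fun n => normc (u n))).
Proof.
split; first by exists (normc (u 0%N)), 0%N.
have /cvg_seq_bounded/pinfty_ex_gt0[M _ uM] : cvgn (u : nat -> C).
  by apply/cvg_ex; exists 0; exact: c0_cvg.
exists (complex.Re M) => _ [n _ <-].
have : (normc (u n))%:C <= M by have := uM n I; rewrite /= /Num.norm/=.
by rewrite lecE => /andP[].
Qed.

Lemma sup_norm_ub (u : c0) n : normc (u n) <= sup_norm u.
Proof. by apply: (ub_le_sup (c0_has_sup u).2); exists n. Qed.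

Lemma sup_norm_le (u : c0) (M : R) :
  (forall n, normc (u n) <= M) -> sup_norm u <= M.
Proof.
by move=> uM; apply: ge_sup; [exact: (c0_has_sup u).1 | move=> _ [n _ <-]].
Qed.

Lemma sup_norm_ge0 (u : c0) : 0 <= sup_norm u.
Proof.
by apply: le_trans (sup_norm_ub u 0%N); case: (u 0%N) => a b; exact: sqrtr_ge0.
Qed.

(* The norm of a [normedModType C] takes its values in [C]. *)
Definition c0_norm (u : c0) : C := (sup_norm u)%:C.

Lemma c0_normD (u v : c0) : c0_norm (u + v) <= c0_norm u + c0_norm v.
Proof.
rewrite /c0_norm -rmorphD lecR; apply: sup_norm_le => n.
by rewrite c0_valD (le_trans (le_normcD _ _))// lerD// sup_norm_ub.
Qed.

Lemma sup_normZ_le (a : C) (u : c0) : sup_norm (a *: u) <= normc a * sup_norm u.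
Proof.
apply: sup_norm_le => n; rewrite c0_valZ normcM ler_wpM2l ?sup_norm_ub//.
by case: a => x y; exact: sqrtr_ge0.
Qed.

Lemma c0_normZ (a : C) (u : c0) : c0_norm (a *: u) = `|a| * c0_norm u.
Proof.
have -> : `|a| = (normc a)%:C by case: a.
rewrite /c0_norm -rmorphM; congr _%:C; apply/eqP.
rewrite eq_le sup_normZ_le/=; have [->|a0] := eqVneq a 0.
  by rewrite normc0 mul0r sup_norm_ge0.
have na0 : normc a != 0 by apply: contra a0 => /eqP/eq0_normc ->.
have na_gt0 : 0 < normc a.
  by rewrite lt_neqAle eq_sym na0; case: (a) => x y; exact: sqrtr_ge0.
rewrite -ler_pdivlMl// -normcV -[in leLHS](scale1r u) -(mulVf a0) -scalerA.
exact: sup_normZ_le.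
Qed.

Lemma c0_norm0_eq0 (u : c0) : c0_norm u = 0 -> u = 0.
Proof.
move=> [u0]; apply/c0_val_inj/funext => n; apply: eq0_normc; apply/eqP.
rewrite eq_le -{1}u0 sup_norm_ub/=.
by case: (u n) => a b; exact: sqrtr_ge0.
Qed.

HB.instance Definition _ := Lmodule_isNormed.Build C c0
  c0_normD c0_normZ c0_norm0_eq0.

Lemma c0_normE (u : c0) : `|u| = (sup_norm u)%:C.
Proof. by []. Qed.

End C0.

(* Main.v *)
(* Compose with the n-th coordinate: phi(aba) = phi(a)^2 psi(b) and
   psi(aba) = psi(a)^2 phi(b). Taking for a a unit vector e_m with
   phi(e_m) <> 0 forces psi to be a multiple of the m-th coordinate; if there
   is no such m, then phi = 0 by continuity, and psi = 0 because every element
   of c_0 is a cube. Hence Psi(a)_n = c_n a_(m(n)), and a sparse choice of a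
   shows that the c_n are bounded. *)
Require Import Defs.
From mathcomp Require Import all_boot all_order all_algebra complex.
From mathcomp Require Import all_classical all_reals.
From mathcomp Require Import topology normedtype.

Section C0_Jordan_triple.
Set Implicit Arguments.
Unset Strict Implicit.
Import Order.TTheory GRing.Theory Num.Theory.
Import numFieldNormedType.Exports ComplexField.Normc.
Local Open Scope classical_set_scope.
Local Open Scope complex_scope.
Local Open Scope ring_scope.

Variable R : realType.
Local Notation C := (R[i]^o).

Lemma normc_ge0 (x : C) : 0 <= normc x.
Proof. by case: x => a b; exact: sqrtr_ge0. Qed.

Lemma norm_normc (x : C) : `|x| = (normc x)%:C.
Proof. by case: x. Qed.

Lemma normc_real (r : R) : 0 <= r -> normc r%:C = r.
Proof. by move=> r0; rewrite /normc /= expr0n addr0 sqrtr_sqr ger0_norm. Qed.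

Lemma c0_seq_normcP (u : nat -> C) : u \in @c0_seq R <->
  forall e : R, 0 < e -> exists N, forall n, (N <= n)%N -> normc (u n) < e.
Proof.
split=> [/c0_seqP/cvgr0Pnorm_lt u0 e e0|u0].
  have [|N _ uN] := u0 e%:C; first by rewrite ltcR.
  by exists N => n /uN; rewrite norm_normc ltcR.
(* A positive element of [R[i]] has zero imaginary part, so the complex tolerance is a real one. *)
apply/c0_seqP/cvgr0Pnorm_lt => -[e e'] /[dup] e0.
rewrite ltcE /= => /andP[/eqP e'0 e_gt0].
have [N uN] := u0 e e_gt0; exists N => // n /uN.
by rewrite norm_normc ltcE /= e'0 eqxx.
Qed.

Definition c0_delta_seq (m n : nat) : C := (n == m)%:R.

Lemma c0_delta_subproof m : c0_delta_seq m \in @c0_seq R.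
Proof.
apply/c0_seq_normcP => e e0; exists m.+1 => n mn.
by rewrite /c0_delta_seq gtn_eqF // normc0.
Qed.

Definition c0_delta m : c0 R := MkC0 (c0_delta_subproof m).

Lemma c0_deltaE m n : c0_delta m n = (n == m)%:R.
Proof. by []. Qed.

Lemma c0_delta_mul (a : c0 R) m :
  (c0_delta m * a * c0_delta m)%g = a m *: c0_delta m.
Proof.
apply/c0_val_inj/funext => n; rewrite c0_valZ !c0_valM c0_deltaE.
by have [->|] := eqVneq n m; rewrite ?mul1r // !mulr0.
Qed.

Lemma c0_sum_deltaE (a : c0 R) k n :
  (\sum_(i < k) a i *: c0_delta i : c0 R) n = if (n < k)%N then a n else 0.
Proof.
elim: k => [|k IH]; first by rewrite big_ord0.
rewrite big_ord_recr c0_valD IH c0_valZ c0_deltaE ltnS.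
by case: ltngtP => [_|_|->]; rewrite ?mulr0 ?addr0 // add0r mulr1.
Qed.

(** The truncation error is a tail of a null sequence, hence uniformly small: the unit vectors span
    a dense subspace. *)
Lemma sup_norm_sum_delta (a : c0 R) (e : R) : 0 < e ->
  exists k, sup_norm (a - \sum_(i < k) a i *: c0_delta i) <= e.
Proof.
move=> e0; have /c0_seq_normcP/(_ e e0)[k ak] := c0_valP a.
exists k; apply: sup_norm_le => n.
have -> : (a - \sum_(i < k) a i *: c0_delta i) n =
  a n - (\sum_(i < k) a i *: c0_delta i : c0 R) n by [].
rewrite c0_sum_deltaE; case: ltnP => [|/ak/ltW] ?; last by rewrite subr0.
by rewrite subrr normc0 ltW.
Qed.

Lemma c0_cube_root (a : c0 R) : exists v : c0 R, a = (v * v * v)%g.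
Proof.
pose w n : C := 3.-root (a n : R[i]).
have w3 n : w n * w n * w n = a n.
  by rewrite -expr2 -exprSr; exact: rootCK.
have w0 : w \in @c0_seq R.
  apply/c0_seq_normcP => e e0.
  (* The tolerance is cubed because the modulus of [a n] is the cube of that of [w n]. *)
  have /c0_seq_normcP/(_ (e ^+ 3))[|N aN] := c0_valP a; first exact: exprn_gt0.
  exists N => n /aN; rewrite -w3 !normcM -expr2 -exprSr.
  by rewrite ltr_pXn2r // nnegrE ?normc_ge0 ?ltW.
by exists (MkC0 w0); apply/c0_val_inj/funext => n; rewrite -w3.
Qed.

Lemma c0_continuousP (f : {linear c0 R -> c0 R}) :
  continuous (f : c0 R -> c0 R) <->
  exists M : R, forall x, sup_norm (f x) <= M * sup_norm x.
Proof.
rewrite -linear_bounded_continuous linear_boundedP; split.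
  move=> /pinfty_ex_gt0[[M M'] +] fM; rewrite ltcE => /andP[/eqP /= M'0 _].
  exists M => x; have := fM x.
  by rewrite !c0_normE M'0 -[M +i* _]/(M%:C) -rmorphM lecR.
move=> [M fM]; exists M%:C; split; first by apply/complex_realP; exists M.
move=> [r r'] + x; rewrite ltcE => /andP[/eqP /= r'0 /ltW Mr].
rewrite !c0_normE r'0 -[r +i* _]/(r%:C) -rmorphM lecR.
by apply: le_trans (fM x) _; rewrite ler_wpM2r // sup_norm_ge0.
Qed.

(** The n-th coordinate of [f] is a continuous functional that vanishes on a dense subspace. *)
Lemma c0_coord_eq0 (f : {linear c0 R -> c0 R}) n :
  continuous (f : c0 R -> c0 R) -> (forall m, f (c0_delta m) n = 0) ->
  forall a, f a n = 0.
Proof.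
move=> /c0_continuousP[M fM] f0 a.
have fsum k : f (\sum_(i < k) a i *: c0_delta i) n = 0.
  elim: k => [|k IH]; first by rewrite big_ord0 linear0.
  by rewrite big_ord_recr linearD linearZ c0_valD IH c0_valZ f0 mulr0 addr0.
apply: eq0_normc; apply/eqP; rewrite eq_le normc_ge0 andbT.
apply/ler_addgt0Pr => e e0; rewrite add0r.
(* The bound [M] may be zero or negative; this larger constant can safely be divided by. *)
have M1_gt0 : 0 < `|M| + 1 by rewrite ltr_wpDl.
have [|k ak] := sup_norm_sum_delta a (e := e / (`|M| + 1)).
  by rewrite divr_gt0.
have -> : f a n = f (a - \sum_(i < k) a i *: c0_delta i) n.
  rewrite linearB.
  have -> (u v : c0 R) : (u - v) n = u n - v n by [].
  by rewrite fsum subr0.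
apply: le_trans (sup_norm_ub _ _) (le_trans (fM _) _).
apply: le_trans (_ : (`|M| + 1) * (e / (`|M| + 1)) <= e); last first.
  by rewrite mulrC divfK // gt_eqF.
apply: (le_trans _ (ler_wpM2l (ltW M1_gt0) ak)).
rewrite ler_wpM2r ?sup_norm_ge0 // (le_trans (ler_norm M)) // lerDl.
exact: ler01.
Qed.

Lemma jordan_triple_coord (Phi Psi : {linear c0 R -> c0 R}) n :
  continuous (Phi : c0 R -> c0 R) -> jordan_triple_multiplicative Phi Psi ->
  exists m (c : C), forall a, Psi a n = c * a m.
Proof.
move=> Phi_cont [PhiJ PsiJ].
have [[m Phim]|Phi0] := pselect (exists m, Phi (c0_delta m) n != 0).
  exists m, (Phi (c0_delta m) n)^-1 => a.
  have : Phi (c0_delta m * a * c0_delta m)%g n =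
         (Phi (c0_delta m) * Psi a * Phi (c0_delta m))%g n by rewrite PhiJ.
  rewrite c0_delta_mul linearZ c0_valZ !c0_valM.
  (* With [p] the n-th coordinate of [Phi (c0_delta m)], the identity reads
     [a m * p = p * Psi a n * p]; one factor [p] cancels. *)
  rewrite -mulrA mulrC => /(mulfI Phim) ->.
  by rewrite mulrC mulfK.
have {}Phi0 m : Phi (c0_delta m) n = 0.
  by apply/eqP/negPn/negP => Phim; apply: Phi0; exists m.
(* The weight is zero, so the index is arbitrary. *)
exists 0%N, 0 => a; have [v ->] := c0_cube_root a.
by rewrite PsiJ !c0_valM (c0_coord_eq0 Phi_cont Phi0) mulr0 !mul0r.
Qed.

(* Otherwise pick [n k] with [normc (c (n k)) > (k + 1)^2]; the sequence equal
   to [1 / (k + 1)] at [m (n k)], for the least such [k], lies in [c0] but has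
   unbounded image. *)
Lemma weighted_reindexing_bounded (m : nat -> nat) (c : nat -> C)
    (f : c0 R -> c0 R) :
  (forall a n, f a n = c n * a (m n)) ->
  exists M : R, forall n, normc (c n) <= M.
Proof.
move=> fE; apply: contrapT => unbounded.
have /choice[n cn] k : exists n, k.+1%:R ^+ 2 < normc (c n).
  apply: contrapT => small; apply: unbounded; exists (k.+1%:R ^+ 2) => n.
  by rewrite leNgt; apply/negP => cn; apply: small; exists n.
pose hit j := [pred k | m (n k) == j].
pose w j : R := if pselect (exists k, hit j k) is left ex
  then (ex_minn ex).+1%:R^-1 else 0.
have w_ge0 j : 0 <= w j by rewrite /w; case: pselect => // ex; rewrite invr_ge0.
have w0 : (fun j => (w j)%:C : C) \in @c0_seq R.
  apply/c0_seq_normcP => e e0.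
  have [N eN] : exists N : nat, e^-1 < N%:R.
    by exists (Num.truncn e^-1).+1; exact: truncnS_gt.
  (* Past this maximum, [j] can only be hit by some [k >= N], so [w j] is either zero or less than
     [e]. *)
  exists (\max_(i < N) m (n i)).+1 => j max_j.
  rewrite normc_real // /w; case: pselect => // ex.
  case: ex_minnP => k /eqP mk _.
  rewrite invf_plt ?posrE //; apply: lt_le_trans eN _.
  rewrite ler_nat leqNgt; apply/negP => /ltnW k_small.
  have : (m (n k) <= \max_(i < N) m (n i))%N.
    exact: (leq_bigmax (F := fun i : 'I_N => m (n i)) (Ordinal k_small)).
  by rewrite mk leqNgt max_j.
pose a : c0 R := MkC0 w0.
have fa k : k.+1%:R <= sup_norm (f a).
  apply: le_trans (sup_norm_ub _ (n k)).
  rewrite fE normcM normc_real //.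
  (* Several [k] may share one position; the least of them gives the largest value, which serves
     them all. *)
  have wk : k.+1%:R^-1 <= w (m (n k)).
    rewrite /w; case: pselect => [ex|[]]; last by exists k => /=.
    case: ex_minnP => i _ /(_ k); rewrite /= eqxx => /(_ isT) ik.
    by rewrite lef_pV2 ?posrE // ler_nat.
  apply: le_trans (ler_pM _ _ (ltW (cn k)) wk); rewrite ?exprn_ge0 ?invr_ge0 //.
  by rewrite expr2 mulfK ?pnatr_eq0.
(* The integer part of the norm, plus one, exceeds the norm. *)
have := fa (Num.truncn (sup_norm (f a))).
by rewrite leNgt truncnS_gt.
Qed.

End C0_Jordan_triple.

Theorem proposition3p2 (R : realType)
    (Phi Psi : {linear c0 R -> c0 R})
    (Phi_continuous : continuous (Phi : c0 R -> c0 R))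
    (PhiPsi_triple : jordan_triple_multiplicative Phi Psi) :
  continuous (Psi : c0 R -> c0 R).
Proof.
have /choice[m /choice[c PsiE]] n :=
  @jordan_triple_coord R Phi Psi n Phi_continuous PhiPsi_triple.
have [M cM] := @weighted_reindexing_bounded R m c Psi (fun a n => PsiE n a).
(* A common bound for the weights is an operator bound, since each [a (m n)] is at most [sup_norm a]
   in modulus. *)
apply/c0_continuousP; exists M => a; apply: sup_norm_le => n.
rewrite PsiE Normc.normcM; apply: Num.Theory.ler_pM => //.
- exact: normc_ge0.
- exact: normc_ge0.
- exact: sup_norm_ub.
Qed.
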